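(* Let $a$ and $b$ be nonzero coprime integers. Let $p$ be an odd prime such that $p\nmid ab$, let $e$ be a positive integer, and let $0\le T<k$ be integers. Then $p^e\in G_{(T,k)}(a,b)$ if and only if $\operatorname{ord}_p(ab^{-1})$ is even and $$T\equiv \frac{\operatorname{ord}_{p^e}(ab^{-1})}{2}\pmod{\gcd\bigl(k,\operatorname{ord}_{p^e}(ab^{-1})\bigr)}.$$
   Context: For nonzero coprime integers $a,b$ and integers $0\le T<k$, $G_{(T,k)}(a,b)$ denotes the set of positive integers $d$ such that $d\mid (a^{ks+T}+b^{ks+T})$ for some positive integer $s$. For a positive integer $m$ with $\gcd(m,ab)=1$, $\operatorname{ord}_m(ab^{-1})$ is the multiplicative order modulo $m$ of the residue class $ab^{-1}$, where $b^{-1}$ is the inverse of $b$ modulo $m$. *)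

(* Defs.v *)
From mathcomp Require Import all_boot all_order all_algebra all_fingroup.

Set Implicit Arguments.
Unset Strict Implicit.
Unset Printing Implicit Defensive.

Import GRing.Theory.
Local Open Scope ring_scope.

Definition Gset (T k : nat) (a b : int) (d : nat) : Prop :=
  (0 < d)%N /\
  exists s : nat,
    (0 < s)%N /\ (d%:Z %| a ^+ (k * s + T) + b ^+ (k * s + T))%Z.

(* Meant for 0 < m with gcd(m, ab) = 1. If 1 < m then a / b is a unit of Z/m,
   so the default value 1 of insubd is not used. If m = 1 then 'Z_m is Z/2,
   whose unit group is trivial, so the order computed below is 1, the same as
   in Z/1. *)
Definition quot_unit (m : nat) (a b : int) : {unit 'Z_m} :=
  insubd (1%g : {unit 'Z_m}) (a%:~R / b%:~R : 'Z_m).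

Definition ord_quot (m : nat) (a b : int) : nat := #[quot_unit m a b]%g.

(* Main.v *)
Require Import Defs.
From mathcomp Require Import all_boot all_order all_algebra all_fingroup.
From mathcomp Require Import cyclic ring zify.

(** Write [d] for the order of [a / b] modulo [q = p ^ e].  Since [p] is odd
    and does not divide [a b], it divides at most one of [a ^ n - b ^ n] and
    [a ^ n + b ^ n]: a common prime factor would divide [2 a ^ n].  As the product
    of the two is [a ^ (2 n) - b ^ (2 n)], the full power [q] divides
    [a ^ n + b ^ n] exactly when it divides [a ^ (2 n) - b ^ (2 n)] but not
    [a ^ n - b ^ n], that is, when [d] divides [2 n] but not [n]
    ([dvdz_addXn_order]).  Such exponents [n] exist only for even [d], and they
    are then the [n] congruent to [d / 2] modulo [d]
    ([dvdn_double_half_order]).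

    It remains to see when the progression [k s + T], [s > 0], meets that
    class; by Bezout this happens exactly when [T] and [d / 2] agree modulo
    [gcd k d] ([arith_progression_meets_class]).

    Finally, [d] and the order modulo [p] have the same parity.  The order
    modulo [p] divides [d], and conversely [d] divides it times [p ^ (e - 1)],
    because raising to the power [p] lifts a congruence from [p ^ i] to
    [p ^ i.+1] ([dvdz_subX_expn]); the factor [p ^ (e - 1)] is odd. *)

Set Implicit Arguments.
Unset Strict Implicit.
Unset Printing Implicit Defensive.

Import GRing.Theory.

(** * The order of a quotient and divisibility of differences of powers *)

Section Order.
Local Open Scope ring_scope.

Lemma PoszX (p e : nat) : (p ^ e)%N%:Z = p%:Z ^+ e.
Proof. by rewrite -[LHS]natz natrX natz. Qed.

Lemma intr_Zp_eq0 (m : nat) (z : int) :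
  (1 < m)%N -> (z%:~R == 0 :> 'Z_m) = (m%:Z %| z)%Z.
Proof.
move=> m_gt1; have natE (n : nat) : (n%:R == 0 :> 'Z_m) = (m %| n)%N.
  by rewrite -val_eqE /= val_Zp_nat // /dvdn.
case: z => n; first by rewrite -pmulrn natE.
by rewrite NegzE mulrNz oppr_eq0 -pmulrn natE dvdzE abszN.
Qed.

Lemma intr_Zp_unit (m : nat) (z : int) :
  (1 < m)%N -> ((z%:~R : 'Z_m) \is a GRing.unit) = coprimez m%:Z z.
Proof.
move=> m_gt1; case: z => n; first by rewrite -pmulrn unitZpE.
by rewrite NegzE mulrNz unitrN -pmulrn unitZpE // coprimezE abszN.
Qed.

(** Translates the order into integer divisibility, so that orders for
    different moduli can be compared without maps between residue rings. *)
Lemma ord_quot_dvdn (m n : nat) (a b : int) :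
  (1 < m)%N -> coprimez m%:Z a -> coprimez m%:Z b ->
  (ord_quot m a b %| n)%N = (m%:Z %| a ^+ n - b ^+ n)%Z.
Proof.
move=> m_gt1 m_a m_b.
have ua : (a%:~R : 'Z_m) \is a GRing.unit by rewrite intr_Zp_unit.
have ub : (b%:~R : 'Z_m) \is a GRing.unit by rewrite intr_Zp_unit.
have ubn : (b%:~R ^+ n : 'Z_m) \is a GRing.unit by rewrite unitrX.
rewrite /ord_quot order_dvdn -intr_Zp_eq0 // -val_eqE FinRing.val_unitX /=.
rewrite /quot_unit [val _]insubdK ?unitr_div // ?unitrM ?ua ?unitrV //.
rewrite expr_div_n rmorphB /= !rmorphXn /= subr_eq0.
by rewrite -(can_eq (mulrK ubn)) mulrVK // mul1r.
Qed.

(** * Lifting congruences to higher powers of a prime *)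

(** Writing [x ^ p - y ^ p] as [x - y] times a sum of [p] products, modulo
    [p] every product equals [x ^ (p - 1)], so the sum vanishes. *)
Lemma dvdz_subX_lift (p i : nat) (x y : int) :
  (0 < i)%N -> (p%:Z ^+ i %| x - y)%Z ->
  (p%:Z ^+ i.+1 %| x ^+ p - y ^+ p)%Z.
Proof.
move=> i_gt0 dvd_xy; rewrite subrXX exprSr; apply: dvdz_mul => //.
have xy : (y = x %[mod p])%Z.
  apply/eqP; rewrite eq_sym eqz_mod_dvd; apply: dvdz_trans dvd_xy.
  by apply: dvdz_exp.
have termE (j : 'I_p) :
    (p%:Z %| x ^+ (p.-1 - j) * y ^+ j - x ^+ p.-1)%Z.
  have -> : (p.-1 = p.-1 - j + j)%N by have := ltn_ord j; lia.
  rewrite addnK exprD -mulrBr; apply: dvdz_mull.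
  by rewrite -eqz_mod_dvd -modzXm xy modzXm.
have -> : \sum_(j < p) x ^+ (p.-1 - j) * y ^+ j =
    \sum_(j < p) (x ^+ (p.-1 - j) * y ^+ j - x ^+ p.-1) + x ^+ p.-1 * p%:Z.
  rewrite big_split /= sumr_const card_ord mulNrn pmulrn mulrzz.
  by rewrite subrK.
apply: rpredD; last exact: dvdz_mull.
by apply: rpred_sum => j _; exact: termE.
Qed.

Lemma dvdz_subX_expn (p i : nat) (x y : int) :
  (p%:Z %| x - y)%Z ->
  (p%:Z ^+ i.+1 %| x ^+ (p ^ i) - y ^+ (p ^ i))%Z.
Proof.
move=> dvd_xy; elim: i => [|i IHi]; first by rewrite expn0 !expr1.
by rewrite expnSr !exprM dvdz_subX_lift.
Qed.

(** The order modulo [p ^ e] is a multiple of the order modulo [p] by a divisor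
    of the odd number [p ^ e.-1]. *)
Lemma odd_ord_quot_expn (p e : nat) (a b : int) :
  prime p -> odd p -> (0 < e)%N -> coprimez p%:Z a -> coprimez p%:Z b ->
  odd (ord_quot (p ^ e) a b) = odd (ord_quot p a b).
Proof.
move=> p_prime p_odd e_gt0 p_a p_b.
have p_gt1 := prime_gt1 p_prime.
have q_gt1 : (1 < p ^ e)%N by rewrite -(expn0 p) ltn_exp2l.
have qE := PoszX p e.
have q_a : coprimez (p ^ e)%N a by rewrite qE coprimezXl.
have q_b : coprimez (p ^ e)%N b by rewrite qE coprimezXl.
have ord_dvd : (ord_quot p a b %| ord_quot (p ^ e) a b)%N.
  rewrite ord_quot_dvdn //; apply: (@dvdz_trans (p ^ e)%N%:Z).
    by rewrite qE dvdz_exp.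
  by rewrite -ord_quot_dvdn.
have dvd_ord : (ord_quot (p ^ e) a b %| ord_quot p a b * p ^ e.-1)%N.
  rewrite ord_quot_dvdn // qE -(prednK e_gt0) !exprM dvdz_subX_expn //.
  by rewrite -ord_quot_dvdn.
apply/idP/idP => [|ord_odd]; first exact: dvdn_odd.
by apply: (dvdn_odd dvd_ord); rewrite oddM ord_odd oddX p_odd orbT.
Qed.

(** * Sums of powers *)

(** The sum of [u - v] and [u + v] is [2 u], which is prime to [p]. *)
Lemma prime_dvdz_subD (p : nat) (u v : int) :
  prime p -> odd p -> coprimez p%:Z u ->
  (p%:Z %| u - v)%Z -> ~~ (p%:Z %| u + v)%Z.
Proof.
move=> p_prime p_odd p_u dvdB; apply/negP => dvdD.
have : (p%:Z %| 2%:Z * u)%Z.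
  have -> : 2%:Z * u = (u - v) + (u + v) by ring.
  exact: rpredD.
rewrite Gauss_dvdzl // dvdzE /= dvdn_prime2 // => /eqP p2.
by rewrite p2 in p_odd.
Qed.

Lemma coprimez_prime (p : nat) (z : int) :
  prime p -> coprimez p%:Z z = ~~ (p%:Z %| z)%Z.
Proof. by move=> p_prime; rewrite coprimezE prime_coprime // dvdzE. Qed.

(** Only one factor of [(a ^ n - b ^ n) * (a ^ n + b ^ n)] can be divisible by
    [p], so that [p ^ e] divides the product only by dividing one of them. *)
Lemma dvdz_addXn_order (p e n : nat) (a b : int) :
  prime p -> odd p -> (0 < e)%N -> coprimez p%:Z a -> coprimez p%:Z b ->
  ((p ^ e)%N%:Z %| a ^+ n + b ^+ n)%Z =
  (ord_quot (p ^ e) a b %| 2 * n)%N && ~~ (ord_quot (p ^ e) a b %| n)%N.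
Proof.
move=> p_prime p_odd e_gt0 p_a p_b.
have q_gt1 : (1 < p ^ e)%N by rewrite -(expn0 p) ltn_exp2l ?prime_gt1.
have qE := PoszX p e.
have p_q : (p%:Z %| (p ^ e)%N%:Z)%Z by rewrite qE dvdz_exp.
rewrite !ord_quot_dvdn ?qE ?coprimezXl // -qE mulnC !exprM subr_sqr.
have p_an : coprimez p%:Z (a ^+ n) by rewrite coprimezXr.
move: (a ^+ n) (b ^+ n) p_an => u v p_u.
apply/idP/andP => [dvdD | [dvdBD ndvdB]].
  split; first exact: dvdz_mull.
  apply/negP => dvdB; have := prime_dvdz_subD p_prime p_odd p_u
    (dvdz_trans p_q dvdB).
  by rewrite (dvdz_trans p_q dvdD).
have [pB | pNB] := boolP (p%:Z %| u - v)%Z.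
  (* Here [p ^ e] is coprime to [u + v], so it would divide [u - v]. *)
  have := prime_dvdz_subD p_prime p_odd p_u pB.
  rewrite -coprimez_prime // => /(coprimezXl e); rewrite -qE => q_D.
  by rewrite Gauss_dvdzl // (negPf ndvdB) in dvdBD.
move: pNB; rewrite -coprimez_prime // => /(coprimezXl e); rewrite -qE => q_B.
by rewrite Gauss_dvdzr in dvdBD.
Qed.

End Order.

(** * Congruences of natural numbers *)

(** The multiples of half of [d] that are not multiples of [d] are the odd
    multiples of the half. *)
Lemma dvdn_double_half_order (d n : nat) :
  0 < d ->
  (d %| 2 * n) && ~~ (d %| n) = ~~ odd d && (n == d %/ 2 %[mod d]).
Proof.
move=> d_gt0; apply/andP/andP => [[/dvdnP[c nE] dNn] | [d_even /eqP nE]].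
  (* The cofactor [c] of [d] in [2 n] is odd, for otherwise [d] divides [n]. *)
  have c_odd : odd c.
    apply: contraNT dNn => c_even; apply/dvdnP; exists c./2.
    by apply/eqP; rewrite -(eqn_pmul2l (isT : 0 < 2)) nE; lia.
  have d_even : ~~ odd d.
    have : odd (2 * n) = odd (c * d) by rewrite nE.
    by rewrite !oddM c_odd /= => <-.
  split=> //; have -> : n = c./2 * d + d %/ 2.
    have cE : c = c./2.*2.+1 by rewrite -[LHS]odd_double_half c_odd.
    have dE : d = d./2.*2 by rewrite -[LHS]odd_double_half (negPf d_even).
    rewrite divn2; nia.
  by rewrite modnMDl.
have dE : d = 2 * (d %/ 2) by lia.
split.
  by rewrite /dvdn -modnMmr nE modnMmr -dE modnn.
rewrite /dvdn nE modn_small; lia.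
Qed.

(** Multiples of [k] cover, modulo [d], exactly the multiples of [gcdn k d]. *)
Lemma arith_progression_meets_class (k d T r : nat) :
  0 < k -> 0 < d ->
  (exists s, 0 < s /\ k * s + T = r %[mod d]) <-> T = r %[mod gcdn k d].
Proof.
move=> k_gt0 d_gt0; split=> [[s [_ eq_d]] | eq_g].
  have /(congr1 (modn^~ (gcdn k d))) := eq_d.
  rewrite !modn_dvdm ?dvdn_gcdr // => <-.
  have /dvdnP[c cE] : gcdn k d %| k * s by rewrite dvdn_mulr ?dvdn_gcdl.
  by rewrite cE modnMDl.
(* [r + d.-1 * T] stands for [r - T], avoiding truncated subtraction. *)
have /dvdnP[c cE] : gcdn k d %| r + d.-1 * T.
  rewrite /dvdn -modnDml -eq_g modnDml -mulSn prednK //.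
  by apply: dvdn_mulr; exact: dvdn_gcdr.
have [u v uE _] := egcdnP d k_gt0.
(* The summand [d] only makes the solution positive. *)
exists (c * u + d); split; first by rewrite addn_gt0 d_gt0 orbT.
have -> : k * (c * u + d) + T = (c * v + k + T) * d + r.
  have dT : T + d.-1 * T = d * T by rewrite -mulSn prednK.
  have -> : k * (c * u + d) = c * (u * k) + k * d by ring.
  rewrite uE; nia.
by rewrite modnMDl.
Qed.

Theorem theorem5 (a b : int) (p e k T : nat)
    (a_neq0 : a != 0%R) (b_neq0 : b != 0%R) (coprime_ab : coprimez a b)
    (p_prime : prime p) (p_odd : odd p) (p_ndvd_ab : ~~ (p%:Z %| (a * b)%R)%Z)
    (e_gt0 : 0 < e) (T_lt_k : T < k) :
  Gset T k a b (p ^ e) <->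
  ~~ odd (ord_quot p a b) /\
  T = ord_quot (p ^ e) a b %/ 2 %[mod gcdn k (ord_quot (p ^ e) a b)].
Proof.
have /andP[p_a p_b] : coprimez p%:Z a && coprimez p%:Z b.
  by rewrite -coprimezMr coprimez_prime.
have k_gt0 : 0 < k by apply: leq_ltn_trans T_lt_k.
have d_gt0 : 0 < ord_quot (p ^ e) a b by exact: order_gt0.
rewrite -(odd_ord_quot_expn p_prime p_odd e_gt0 p_a p_b).
rewrite -arith_progression_meets_class //.
have dvdP s := etrans (dvdz_addXn_order (k * s + T) p_prime p_odd e_gt0 p_a p_b)
  (dvdn_double_half_order (k * s + T) d_gt0).
split=> [[_ [s [s_gt0]]] | [d_even [s [s_gt0 sE]]]].
  by rewrite dvdP => /andP[d_even /eqP sE]; split=> //; exists s.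
split; first by rewrite expn_gt0 prime_gt0.
by exists s; split=> //; rewrite dvdP d_even; apply/eqP.
Qed.
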